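(* Let $\mathcal{X}$ and $\mathcal{Y}$ be two paired real vector spaces with bilinear form $\langle\cdot,\cdot\rangle$, let $\mathcal{W}$ be a set, let $\theta:\mathcal{W}\to\mathcal{X}$ be a mapping, and let $c_\theta:\mathcal{W}\times\mathcal{Y}\to\overline{\mathbb{R}}$ be the one-sided linear coupling $c_\theta(w,y)=\langle\theta(w),y\rangle$. 1. For any function $g:\mathcal{Y}\to\overline{\mathbb{R}}$, the $c_\theta'$-Fenchel-Moreau conjugate $g^{c_\theta'}:\mathcal{W}\to\overline{\mathbb{R}}$ is given by $g^{c_\theta'}=g^{\star'}\circ\theta$. 2. For any function $h:\mathcal{W}\to\overline{\mathbb{R}}$, the $c_\theta$-Fenchel-Moreau conjugate $h^{c_\theta}:\mathcal{Y}\to\overline{\mathbb{R}}$ is given by $h^{c_\theta}=\big(\inf[h\mid\theta]\big)^{\star}$, and the $c_\theta$-Fenchel-Moreau biconjugate $h^{c_\theta c_\theta'}:\mathcal{W}\to\overline{\mathbb{R}}$ is given by $$h^{c_\theta c_\theta'}=\big(h^{c_\theta}\big)^{\star'}\circ\theta=\big(\inf[h\mid\theta]\big)^{\star\star'}\circ\theta.$$ 3. For any subset $W\subset\mathcal{W}$, $\delta_W^{c_\theta}=\sigma_{\theta(W)}$.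
   Context: $\overline{\mathbb{R}}=[-\infty,+\infty]$. $\mathcal{X}$ and $\mathcal{Y}$ are paired: there are a bilinear form $\langle\cdot,\cdot\rangle:\mathcal{X}\times\mathcal{Y}\to\mathbb{R}$ and locally convex topologies on $\mathcal{X}$ and $\mathcal{Y}$ such that the continuous linear forms on $\mathcal{X}$ are exactly $x\mapsto\langle x,y\rangle$, $y\in\mathcal{Y}$, and those on $\mathcal{Y}$ are exactly $y\mapsto\langle x,y\rangle$, $x\in\mathcal{X}$. Addition $+$ in $\overline{\mathbb{R}}$ below is Moreau's lower addition: $(+\infty)+(-\infty)=(-\infty)+(+\infty)=-\infty$; $\inf\emptyset=+\infty$, $\sup\emptyset=-\infty$. Fenchel conjugates: for $f:\mathcal{X}\to\overline{\mathbb{R}}$, $g:\mathcal{Y}\to\overline{\mathbb{R}}$, $f^\star(y)=\sup_{x\in\mathcal{X}}(\langle x,y\rangle+(-f(x)))$, $g^{\star'}(x)=\sup_{y\in\mathcal{Y}}(\langle x,y\rangle+(-g(y)))$, $f^{\star\star'}=(f^\star)^{\star'}$. For a coupling $c:\mathcal{W}\times\mathcal{Y}\to\overline{\mathbb{R}}$, $h:\mathcal{W}\to\overline{\mathbb{R}}$ and $g:\mathcal{Y}\to\overline{\mathbb{R}}$: $h^{c}(y)=\sup_{w\in\mathcal{W}}(c(w,y)+(-h(w)))$, $g^{c'}(w)=\sup_{y\in\mathcal{Y}}(c(w,y)+(-g(y)))$, $h^{cc'}=(h^c)^{c'}$. Conditional infimum: $\inf[h\mid\theta]:\mathcal{X}\to\overline{\mathbb{R}}$,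 $\inf[h\mid\theta](x)=\inf\{h(w):w\in\mathcal{W},\ \theta(w)=x\}$. $\delta_W$ equals $0$ on $W$ and $+\infty$ outside $W$; for $X\subset\mathcal{X}$, $\sigma_X(y)=\sup_{x\in X}\langle x,y\rangle$ is the support function. *)

(* Defs.v *)
From HB Require Import structures.
From mathcomp Require Import all_boot all_order all_algebra sesquilinear.
From mathcomp Require Import all_classical all_reals.
From mathcomp Require Import ereal topology normedtype.

Set Implicit Arguments.
Unset Strict Implicit.
Unset Printing Implicit Defensive.

Import Order.TTheory GRing.Theory Num.Theory.
Import numFieldNormedType.Exports.

Local Open Scope classical_set_scope.
Local Open Scope ring_scope.
Local Open Scope ereal_scope.

(* The locally convex topologies of the pairing are those carried by the
   [tvsType] structures of [X] and [Y]. *)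
Definition paired (R : realType) (X Y : tvsType R)
    (form : {bilinear X -> Y -> R | *%R & *%R}) : Prop :=
  (forall l : {scalar X},
     continuous l <-> exists y : Y, forall x : X, l x = form x y) /\
  (forall l : {scalar Y},
     continuous l <-> exists x : X, forall y : Y, l y = form x y).

(* Throughout, [+] on [\bar R] is [adde], for which
   +oo + -oo = -oo + +oo = -oo: it is Moreau's lower addition. *)

Section Fenchel.
Variables (R : realType) (X Y : tvsType R).
Variable form : {bilinear X -> Y -> R | *%R & *%R}.

Definition fenchel_conj (f : X -> \bar R) : Y -> \bar R :=
  fun y => ereal_sup [set (form x y)%:E + (- f x) | x in [set: X]].

Definition fenchel_conj' (g : Y -> \bar R) : X -> \bar R :=
  fun x => ereal_sup [set (form x y)%:E + (- g y) | y in [set: Y]].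

Definition fenchel_biconj (f : X -> \bar R) : X -> \bar R :=
  fenchel_conj' (fenchel_conj f).

Definition support_function (A : set X) : Y -> \bar R :=
  fun y => ereal_sup [set (form x y)%:E | x in A].

Definition one_sided_linear_coupling (W : Type) (theta : W -> X) :
    W -> Y -> \bar R :=
  fun w y => (form (theta w) y)%:E.

End Fenchel.

Section FenchelMoreau.
Variables (R : realType) (W Y : Type) (c : W -> Y -> \bar R).

Definition fm_conj (h : W -> \bar R) : Y -> \bar R :=
  fun y => ereal_sup [set c w y + (- h w) | w in [set: W]].

Definition fm_conj' (g : Y -> \bar R) : W -> \bar R :=
  fun w => ereal_sup [set c w y + (- g y) | y in [set: Y]].

Definition fm_biconj (h : W -> \bar R) : W -> \bar R :=
  fm_conj' (fm_conj h).

End FenchelMoreau.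

Definition cond_inf (R : realType) (W X : Type)
    (h : W -> \bar R) (theta : W -> X) : X -> \bar R :=
  fun x => ereal_inf [set h w | w in [set w | theta w = x]].

(* Convex-analysis indicator: 0 on [A], +oo outside. *)
Definition delta (R : realType) (W : Type) (A : set W) : W -> \bar R :=
  fun w => if w \in A then 0 else +oo.
Arguments delta R {W} A.

(* Main.v *)
(** For finite [r], the map [a |-> r - a] is self-adjoint for the reversed order
    of the extended reals, so it exchanges infima and suprema. The conjugate of
    the conditional infimum is then an iterated supremum over the fibres of
    [theta], that is, a supremum over [W]. *)

Require Import Defs.
From HB Require Import structures.
From mathcomp Require Import all_boot all_order all_algebra sesquilinear.
From mathcomp Require Import all_classical all_reals.
From mathcomp Require Import ereal topology normedtype.

Import Order.TTheory GRing.Theory Num.Theory.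

Local Open Scope classical_set_scope.
Local Open Scope ring_scope.

(** Infinite values cause no exception: as [r] is finite, [r%:E - a] is infinite exactly when [a]
    is, with the opposite sign. *)
Lemma lee_fin_subC (R : realDomainType) (r : R) (a b : \bar R) :
  (r%:E - a <= b)%E = (r%:E - b <= a)%E.
Proof.
by case: a b => [a| |] [b| |]; rewrite //= ?leey ?leNye // !lee_fin lerBlDl lerBlDr.
Qed.

Lemma fenchel_conj_cond_inf (R : realType) (X Y : tvsType R)
    (form : {bilinear X -> Y -> R | *%R & *%R}) (W : Type) (theta : W -> X)
    (h : W -> \bar R) :
  fenchel_conj form (cond_inf h theta) =
  fm_conj (one_sided_linear_coupling form theta) h.
Proof.
apply/funext => y; apply/eqP; rewrite eq_le; apply/andP; split.
  (* The swap turns the goal into a lower bound on the infimum over the fibre of [x], which is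
     vacuous when that fibre is empty. *)
  apply: ge_ereal_sup => _ [x _ <-]; rewrite lee_fin_subC.
  apply: le_ereal_inf_tmp => _ [w /= <- <-]; rewrite lee_fin_subC.
  by apply: ereal_sup_ubound; exists w.
apply: ge_ereal_sup => _ [w _ <-].
(* The point [theta w] is chosen because [w] lies in its fibre, so the conditional infimum there is
   at most [h w]. *)
apply: le_trans (ereal_sup_ubound _); last by exists (theta w).
by rewrite leeD2l// leeN2; apply: ereal_inf_lbound; exists w.
Qed.

Lemma fm_conj_delta (R : realType) (X Y : tvsType R)
    (form : {bilinear X -> Y -> R | *%R & *%R}) (W : Type) (theta : W -> X)
    (A : set W) :
  fm_conj (one_sided_linear_coupling form theta) (delta R A) =
  support_function form (theta @` A).
Proof.
apply/funext => y; apply/eqP; rewrite eq_le; apply/andP; split.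
  apply: ge_ereal_sup => _ [w _ <-]; rewrite /delta.
  (* Outside [A] the term is a finite number plus [-oo], hence [-oo], and does not affect the
     supremum. *)
  case: ifPn => [/set_mem Aw|_]; last by rewrite leNye.
  rewrite oppe0 adde0; apply: ereal_sup_ubound.
  by exists (theta w) => //; exists w.
apply: ge_ereal_sup => _ [_ [w Aw <-] <-]; apply: ereal_sup_ubound.
by exists w => //; rewrite /delta mem_set// oppe0 adde0.
Qed.

Theorem proposition2p5 (R : realType) (X Y : tvsType R)
    (form : {bilinear X -> Y -> R | *%R & *%R}) (pairedXY : paired form)
    (W : Type) (theta : W -> X) :
  let c := one_sided_linear_coupling form theta in
  (forall g : Y -> \bar R,
     fm_conj' c g = fenchel_conj' form g \o theta) /\
  (forall h : W -> \bar R,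
     fm_conj c h = fenchel_conj form (cond_inf h theta) /\
     fm_biconj c h = fenchel_conj' form (fm_conj c h) \o theta /\
     fenchel_conj' form (fm_conj c h) \o theta =
       fenchel_biconj form (cond_inf h theta) \o theta) /\
  (forall A : set W,
     fm_conj c (delta R A) = support_function form (theta @` A)).
Proof.
(* The first item holds by unfolding, since the coupling sees [w] only through [theta w]; taking [g]
   to be [fm_conj c h] then gives the biconjugate. *)
move=> c; split=> [//|]; split=> [h|A]; last exact: fm_conj_delta.
by rewrite /fenchel_biconj fenchel_conj_cond_inf.
Qed.
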